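(* Let $M$ be a compact Riemannian manifold of dimension $d\ge 1$, let $f:M\to M$ be a $C^1$ map, and let $\Lambda\subseteq M$ be a compact invariant set which contains no critical points of $f$. Suppose that every $\lambda'\in\mathcal L(f)$ satisfies $\lambda'>0$. Then $\Lambda$ is uniformly expanding, i.e. there exist constants $C,\lambda>0$ such that $$\|Df^n_x(v)\|\ge Ce^{\lambda n}\|v\|$$ for all $x\in\Lambda$, all $v\in T_xM$ and all $n\ge 1$.
   Context: Invariant means $f(\Lambda)\subseteq\Lambda$. A point $x$ is a critical point of $f$ if $\det Df_x=0$. $\mathcal L(f)$ denotes the set of all Lyapunov exponents of $f$ on $\Lambda$: the set of all $\lambda\in\mathbb R$ for which there exist a point $x\in\Lambda$ and a nonzero vector $v\in T_xM$ such that the limit $\lim_{n\to\infty}\frac1n\log\|Df^n_x(v)\|$ exists and equals $\lambda$. *)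

(* Defs.v *)
From HB Require Import structures.
From mathcomp Require Import all_boot all_order all_algebra.
From mathcomp Require Import all_classical all_reals all_analysis.
Set Implicit Arguments.
Unset Strict Implicit.
Unset Printing Implicit Defensive.
Import Order.TTheory GRing.Theory Num.Theory.
Import numFieldNormedType.Exports.
Local Open Scope classical_set_scope.
Local Open Scope ring_scope.

(* [U] is meant to be open.  In finite dimension, [f] is C^k+1 on [U] iff it is
   differentiable on [U] with all its directional derivatives C^k on [U]. *)
Fixpoint Ck_on (R : realType) (V W : normedModType R) (k : nat) (U : set V)
    (f : V -> W) : Prop :=
  if k is k'.+1 then
    (forall x, U x -> differentiable f x) /\
    (forall v : V, Ck_on k' U (fun x => 'D_v f x))
  else forall x, U x -> {for x, continuous f}.

Definition smooth_on (R : realType) (V W : normedModType R) (U : set V)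
    (f : V -> W) : Prop :=
  forall k, Ck_on k U f.

(* [chart_map] and [chart_inv] are total functions, relevant only on
   [chart_dom] and on its image respectively. *)
Record chart (R : realType) (d : nat) (M : topologicalType) := Chart {
  chart_dom : set M;
  chart_map : M -> 'rV[R]_d;
  chart_inv : 'rV[R]_d -> M;
  chart_dom_open : open chart_dom;
  chart_img_open : open (chart_map @` chart_dom);
  chart_mapK : forall x, chart_dom x -> chart_inv (chart_map x) = x;
  chart_map_continuous :
    forall x, chart_dom x -> {for x, continuous chart_map};
  chart_inv_continuous :
    forall y, (chart_map @` chart_dom) y -> {for y, continuous chart_inv}
}.

(* Smooth manifolds without boundary, of dimension [d].  The atlas need not be
   maximal; [chart_at] is a choice of a chart of the atlas around each point. *)
Record manifold (R : realType) (d : nat) := Manifold {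
  manifold_space :> topologicalType;
  manifold_hausdorff : hausdorff_space manifold_space;
  manifold_second_countable : @second_countable manifold_space;
  atlas : set (chart R d manifold_space);
  chart_at : manifold_space -> chart R d manifold_space;
  chart_at_atlas : forall x, atlas (chart_at x);
  chart_at_dom : forall x, chart_dom (chart_at x) x;
  atlas_compatible : forall a b, atlas a -> atlas b ->
    smooth_on (chart_map a @` (chart_dom a `&` chart_dom b))
              (chart_map b \o chart_inv a)
}.

(* T_xM, a tangent vector being given by its coordinates in [chart_at M x]. *)
Definition tangent (R : realType) (d : nat) (M : manifold R d) (x : M) :
  lmodType R := 'rV[R]_d.

(* The vector of T_pM, p = chart_inv a y, with coordinates [u] in the chart
   [a], i.e. the coordinates of that vector in [chart_at M p]. *)
Definition tangent_of_chart (R : realType) (d : nat) (M : manifold R d)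
    (a : chart R d M) (y u : 'rV[R]_d) : tangent (chart_inv a y) :=
  'd (chart_map (chart_at (chart_inv a y)) \o chart_inv a) y u.

(* [metric_smooth]: the coefficients of the metric in each chart are smooth. *)
Record riemannian_metric (R : realType) (d : nat) (M : manifold R d) :=
  RiemannianMetric {
  metric :> forall x : M, tangent x -> tangent x -> R;
  metric_sym : forall x (v w : tangent x), metric v w = metric w v;
  metric_linear : forall x (a : R) (u v w : tangent x),
    metric (a *: u + v) w = a * metric u w + metric v w;
  metric_pos : forall x (v : tangent x), v != 0 -> 0 < metric v v;
  metric_smooth : forall a, atlas a -> forall u w : 'rV[R]_d,
    smooth_on (chart_map a @` chart_dom a)
      (fun y => metric (tangent_of_chart a y u) (tangent_of_chart a y w) : R^o)
}.

Definition tangent_norm (R : realType) (d : nat) (M : manifold R d)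
    (g : riemannian_metric M) (x : M) (v : tangent x) : R :=
  Num.sqrt (g x v v).

Definition C1_map (R : realType) (d : nat) (M : manifold R d) (f : M -> M) :
    Prop :=
  continuous f /\
  forall a b, atlas a -> atlas b ->
    Ck_on 1 (chart_map a @` (chart_dom a `&` f @^-1` chart_dom b))
            (chart_map b \o f \o chart_inv a).

Definition tangent_map (R : realType) (d : nat) (M : manifold R d)
    (f : M -> M) (x : M) : {linear tangent x -> tangent (f x)} :=
  'd (chart_map (chart_at (f x)) \o f \o chart_inv (chart_at x))
     (chart_map (chart_at x) x).

(* The value of the determinant depends on the bases of T_xM and T_{f x}M, but
   its vanishing does not. *)
Definition critical_point (R : realType) (d : nat) (M : manifold R d)
    (f : M -> M) (x : M) : Prop :=
  \det (lin1_mx (tangent_map f x : 'rV[R]_d -> 'rV[R]_d)) = 0.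

(* Since [ln 0 = 0], the vectors killed by some Df^n_x are excluded: for them
   the limit is -oo. *)
Definition lyapunov_exponents (R : realType) (d : nat) (M : manifold R d)
    (g : riemannian_metric M) (f : M -> M) (L : set M) : set R :=
  [set l | exists x (v : tangent x), [/\ L x, v != 0,
    forall n, tangent_map (iter n f) x v != 0 &
    (fun n : nat => n%:R^-1 * ln (tangent_norm g (tangent_map (iter n f) x v)))
      @ \oo --> l]].

Definition uniformly_expanding (R : realType) (d : nat) (M : manifold R d)
    (g : riemannian_metric M) (f : M -> M) (L : set M) : Prop :=
  exists C lambda : R, [/\ 0 < C, 0 < lambda &
    forall (x : M) (v : tangent x) (n : nat), L x -> (1 <= n)%N ->
      C * expR (lambda * n%:R) * tangent_norm g v
        <= tangent_norm g (tangent_map (iter n f) x v)].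

(* Main.v *)
Require Import Defs.
From mathcomp Require Import all_boot all_order all_algebra.
From mathcomp Require Import all_classical all_reals all_analysis.
From mathcomp Require Import ring lra.
Import numFieldNormedType.Exports.
Local Open Scope classical_set_scope.
Local Open Scope ring_scope.

(** Write z = (p, v) for a nonzero tangent vector v at a point p of L, F for the
    map (p, v) |-> (f p, Df v) and nu z for the norm of v.  Call a real c slow
    when a single z satisfies nu (F^n z) <= e^(c n) nu z for every n.

    If c is not slow, every z is stretched at some time n by more than e^(c n).
    The unit sphere bundle over L is compact and the stretching is a continuous
    function of (p, v), so these times are bounded by some N, and the same holds
    for some c' > c (lemma [uniformly_stretched]).  Concatenating orbit
    segments of length at most N, with a uniform lower bound on the stretching
    of one step for the last incomplete segment, gives
    nu (F^n z) >= K e^(c n) nu z for all z and n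
    (lemma [grows_at_rate_of_bounded_times]).  The one-step bound is where the
    absence of critical points is used, again through compactness.

    Hence if some c > 0 is not slow, L is uniformly expanding.  Otherwise the
    set of slow numbers is nonempty; it is bounded below by the one-step bound,
    and its infimum alpha <= 0 is itself slow, because not being slow is an
    open condition.  A vector z that witnesses this has
    nu (F^n z) <= e^(alpha n) nu z, while every c < alpha is not slow and so
    nu (F^n z) >= K_c e^(c n) nu z.  Therefore (1/n) log nu (F^n z) converges to
    alpha: it is a nonpositive Lyapunov exponent, against the hypothesis
    (lemma [least_exponent]).  The smallest exponent is thus attained at some
    vector, without recourse to invariant measures or an ergodic theorem.

    The remaining work is the continuity of the stretching.  Tangent vectors are
    given by their coordinates in a chart chosen pointwise, which jumps from one
    point to the next.  All estimates are therefore made with coordinates in one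
    chart around a point, transported by the linear isomorphisms [frame]. *)

Set Implicit Arguments.
Unset Strict Implicit.
Unset Printing Implicit Defensive.
Import Order.TTheory GRing.Theory Num.Theory.

(** * Maps that agree near a point *)

Section NearDifferential.
Context {R : realType} {V W : normedModType R}.
Implicit Types f g : V -> W.

Lemma near_eq_differential f g (x : V) : (\near x, f x = g x) ->
  differentiable f x -> differentiable g x /\ 'd g x = 'd f x :> (V -> W).
Proof.
move=> fg df.
have cdf : continuous ('d f x) by exact: diff_continuous.
(* [f] and [g] have the same Taylor expansion at [x], and such an expansion
   determines the differential. *)
have gE : g \o shift x = cst (g x) + 'd f x +o_ 0 id.
  have fgx : f x = g x by exact: nbhs_singleton fg.
  apply/eqaddoP => e e0; rewrite near_simpl.
  have fE : f \o shift x = cst (f x) + 'd f x +o_ 0 id by exact: diff_locally.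
  move/eqaddoP : fE => /(_ e e0); rewrite near_simpl.
  have fg0 : \forall y \near 0, f (y + x) = g (y + x).
    move: fg; rewrite (near_shift 0 x) => fg.
    by apply: filterS fg => y /=; rewrite subr0.
  by apply: filterS2 fg0 => y /= fgy; rewrite !fctE /= fgy fgx.
have dg := diff_unique cdf gE.
by split=> //; apply/diff_locallyP; rewrite dg.
Qed.
End NearDifferential.

Lemma near_fst (T U : topologicalType) (t : T) (u : U) (P : set T) :
  (\forall s \near t, P s) -> \forall z \near (t, u), P z.1.
Proof.
move=> tP; exists (P, setT) => /=; first by split=> //; exact: filterT.
by move=> z [].
Qed.

Lemma near_eq_continuous (T U : topologicalType) (f g : T -> U) (t : T) :
  (\forall s \near t, f s = g s) ->
  {for t, continuous f} -> {for t, continuous g}.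
Proof.
move=> fg cf; rewrite /prop_for /continuous_at -(nbhs_singleton fg).
by apply: cvg_trans cf; exact: near_eq_cvg.
Qed.

(** * The differential in charts *)

Section TangentMap.
Context {R : realType} {d : nat} {M : manifold R d}.
Implicit Types (a b c : chart R d M) (h k : M -> M) (p : M).

Definition chart_rep a b h : 'rV[R]_d -> 'rV[R]_d :=
  chart_map b \o h \o chart_inv a.

(** The differential of [h] at [p], from the coordinates in [a] to those in [b].
    Both [tangent_map h p] and, for [h = id], the transition from one chart to
    another are instances; so [chart_diff_comp] below is at once the chain rule
    and the rule for changing coordinates. *)
Definition chart_diff a b h p : {linear 'rV[R]_d -> 'rV[R]_d} :=
  'd (chart_rep a b h) (chart_map a p).

(** The differential is required to be jointly continuous in the point and the
    vector, i.e. continuous on the tangent bundle.  Unlike the continuity of each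
    directional derivative, this form passes to compositions at once, by the
    chain rule. *)
Definition continuously_differentiable h := continuous h /\
  forall a b, atlas a -> atlas b ->
    forall p, chart_dom a p -> chart_dom b (h p) ->
      differentiable (chart_rep a b h) (chart_map a p) /\
      forall u, {for (p, u),
        continuous (fun z : M * 'rV[R]_d => chart_diff a b h z.1 z.2)}.

Lemma near_chart_dom a h p : continuous h -> chart_dom a (h p) ->
  \forall q \near p, chart_dom a (h q).
Proof.
by move=> ch ahp; apply: ch; apply: open_nbhs_nbhs; split=> //; exact: chart_dom_open.
Qed.

Lemma chart_dom_nbhs a p : chart_dom a p -> \forall q \near p, chart_dom a q.
Proof. by apply: (@near_chart_dom a id) => q; exact: cvg_id. Qed.

(** Near a point the differential is the finite sum of the coordinates of the
    vector times the partial derivatives, which are continuous. *)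
Lemma C1_map_continuously_differentiable h :
  C1_map h -> continuously_differentiable h.
Proof.
move=> [ch hC1]; split=> // a b aA bA p ap bhp.
have [dF cF] := hC1 _ _ aA bA.
split=> [|u]; first by apply: dF; exists p.
have hE : \forall z \near (p, u),
    \sum_(i < d) (z.2 : 'rV[R]_d) 0 i *:
      'D_(delta_mx 0 i) (chart_rep a b h) (chart_map a z.1) =
    chart_diff a b h z.1 z.2.
  have : \forall z \near (p, u), chart_dom a z.1 /\ chart_dom b (h z.1).
    apply: (@near_fst _ _ p u (fun q => chart_dom a q /\ chart_dom b (h q))).
    apply: filterI; last exact: near_chart_dom.
    exact: chart_dom_nbhs.
  apply: filterS => -[q v] /= [aq bq].
  have dFq : differentiable (chart_rep a b h) (chart_map a q) by apply: dF; exists q.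
  rewrite [in RHS](row_sum_delta v) linear_sum; apply: eq_bigr => i _.
  by rewrite linearZ /= deriveE.
apply: near_eq_continuous hE _.
apply: (@cvg_big _ _ +%R 0); first exact: add_continuous.
move=> i _; apply: cvgZ.
  apply: (@cvg_comp _ _ _ snd (fun v : 'rV[R]_d => v 0 i)).
    exact: cvg_snd.
  exact: coord_continuous.
have cD : {for p, continuous ('D_(delta_mx 0 i) (chart_rep a b h) \o chart_map a)}.
  apply: continuous_comp; first exact: chart_map_continuous.
  by apply: cF; exists p.
exact: (@cvg_comp _ _ _ fst _ _ (nbhs p) _ cvg_fst cD).
Qed.

Lemma id_continuously_differentiable : continuously_differentiable id.
Proof.
apply: C1_map_continuously_differentiable; split; first by move=> p.
by move=> a b aA bA; exact: (atlas_compatible aA bA 1%N).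
Qed.

(** The two sides can differ where [h] leaves the domain of the intermediate
    chart, so that the equality holds only near the point. *)
Lemma chart_rep_comp a b c h k p : continuous h ->
  chart_dom a p -> chart_dom b (h p) ->
  \forall y \near chart_map a p,
    (chart_rep b c k \o chart_rep a b h) y = chart_rep a c (k \o h) y.
Proof.
move=> ch ap bhp.
have ciq : chart_inv a @ chart_map a p --> p.
  rewrite -[X in _ --> X](chart_mapK ap); apply: chart_inv_continuous.
  by exists p.
have : \forall y \near chart_map a p, chart_dom b (h (chart_inv a y)).
  exact: (ciq _ (near_chart_dom ch bhp)).
by apply: filterS => y /chart_mapK; rewrite /chart_rep /= => ->.
Qed.

Section Composition.
Context {h k : M -> M} {a b c : chart R d M} {p : M}.
Hypotheses (hC1 : continuously_differentiable h)
  (kC1 : continuously_differentiable k)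
  (aA : atlas a) (bA : atlas b) (cA : atlas c)
  (ap : chart_dom a p) (bhp : chart_dom b (h p)) (ckhp : chart_dom c (k (h p))).

Let chart_rep_img : chart_rep a b h (chart_map a p) = chart_map b (h p).
Proof. by rewrite /chart_rep /= chart_mapK. Qed.

Let dh : differentiable (chart_rep a b h) (chart_map a p).
Proof. by have [_ /(_ _ _ aA bA _ ap bhp)[]] := hC1. Qed.

Let dk : differentiable (chart_rep b c k) (chart_rep a b h (chart_map a p)).
Proof.
rewrite chart_rep_img.
by have [_ /(_ _ _ bA cA _ bhp ckhp)[]] := kC1.
Qed.

Lemma chart_rep_differentiable_comp :
  differentiable (chart_rep a c (k \o h)) (chart_map a p).
Proof.
have [ch _] := hC1.
have E := chart_rep_comp c k ch ap bhp.
by have [] := near_eq_differential E (differentiable_comp dh dk).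
Qed.

Lemma chart_diff_comp u :
  chart_diff a c (k \o h) p u = chart_diff b c k (h p) (chart_diff a b h p u).
Proof.
have [ch _] := hC1.
have E := chart_rep_comp c k ch ap bhp.
have [_ /(congr1 (@^~ u)) dE] := near_eq_differential E (differentiable_comp dh dk).
rewrite {2}/chart_diff -chart_rep_img; apply: etrans dE _.
exact: (congr1 (@^~ u) (diff_comp dh dk)).
Qed.

End Composition.

Lemma continuously_differentiable_comp h k : continuously_differentiable h ->
  continuously_differentiable k -> continuously_differentiable (k \o h).
Proof.
move=> hC1 kC1; have [ch Dh] := hC1; have [ck Dk] := kC1.
split; first by move=> p; apply: continuous_comp; [exact: ch|exact: ck].
move=> a c aA cA p ap ckhp.
pose b := chart_at (h p).
have bA : atlas b by exact: chart_at_atlas.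
have bhp : chart_dom b (h p) by exact: chart_at_dom.
split; first exact: (chart_rep_differentiable_comp hC1 kC1 aA bA cA).
move=> u.
have hE : \forall z \near (p, u), chart_diff b c k (h z.1) (chart_diff a b h z.1 z.2) =
    chart_diff a c (k \o h) z.1 z.2.
  have : \forall z \near (p, u), [/\ chart_dom a z.1, chart_dom b (h z.1) &
     chart_dom c (k (h z.1))].
    apply: (@near_fst _ _ p u (fun q =>
      [/\ chart_dom a q, chart_dom b (h q) & chart_dom c (k (h q))])).
    near=> q; split.
    - by near: q; exact: chart_dom_nbhs.
    - by near: q; exact: near_chart_dom.
    - near: q; apply: (@near_chart_dom c (k \o h)) => //.
      by move=> q; apply: continuous_comp; [exact: ch|exact: ck].
  apply: filterS => -[q v] [aq bhq ckhq].
  by symmetry; exact: (chart_diff_comp hC1 kC1 aA bA cA aq bhq ckhq).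
apply: near_eq_continuous hE _.
have [_ cDh] := Dh a b aA bA p ap bhp.
have [_ cDk] := Dk b c bA cA _ bhp ckhp.
have ch1 : h z.1 @[z --> (p, u)] --> h p.
  exact: (@cvg_comp _ _ _ fst h _ (nbhs p) _ cvg_fst (ch p)).
have ch2 : (h z.1, chart_diff a b h z.1 z.2) @[z --> (p, u)] -->
    (h p, chart_diff a b h p u).
  exact: (@cvg_pair _ _ _ (nbhs (p, u)) _ _ _ _ _ (fun z => h z.1)
    (fun z => chart_diff a b h z.1 z.2) ch1 (cDh u)).
exact: (cvg_comp _ (fun z => chart_diff b c k z.1 z.2) ch2 (cDk _)).
Unshelve. all: by end_near. Qed.

Lemma iter_continuously_differentiable f n : continuously_differentiable f ->
  continuously_differentiable (iter n f).
Proof.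
move=> fC1; elim: n => [|n ih]; first exact: id_continuously_differentiable.
exact: continuously_differentiable_comp.
Qed.

Lemma tangent_map_comp h k p (v : tangent p) : continuously_differentiable h ->
  continuously_differentiable k ->
  tangent_map (k \o h) p v = tangent_map k (h p) (tangent_map h p v).
Proof.
move=> hC1 kC1.
apply: (@chart_diff_comp h k (chart_at p) (chart_at (h p)) (chart_at (k (h p))));
 by [exact: hC1|exact: kC1|exact: chart_at_atlas|exact: chart_at_dom].
Qed.

Lemma tangent_map_inj h p : ~ critical_point h p -> forall v : tangent p,
  tangent_map h p v = 0 -> v = 0.
Proof.
move=> /eqP hp v hv.
have : (v : 'rV[R]_d) *m lin1_mx (tangent_map h p : 'rV[R]_d -> 'rV[R]_d) = 0.
  by rewrite mul_rV_lin1.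
move=> /(congr1 (mulmx^~ (invmx (lin1_mx (tangent_map h p : 'rV[R]_d -> 'rV[R]_d))))).
by rewrite mul0mx mulmxK // unitmxE unitfE.
Qed.

End TangentMap.

(** * Continuity of the norm of a differential *)

Section Frames.
Context {R : realType} {d : nat} {M : manifold R d}.
Implicit Types (a b c : chart R d M) (h : M -> M) (p : M).

(** The map from coordinates in [a] to vectors of [tangent p].  With [a] fixed the
    norm of its values is continuous in [p]; nothing of the kind holds for the
    coordinates in [chart_at p], which represent the elements of [tangent p],
    since [chart_at p] may change abruptly with [p]. *)
Definition frame a p : {linear 'rV[R]_d -> tangent p} :=
  chart_diff a (chart_at p) id p.

Definition coframe a p : {linear tangent p -> 'rV[R]_d} :=
  chart_diff (chart_at p) a id p.

Lemma chart_diff_id a p u : chart_dom a p -> chart_diff a a id p u = u.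
Proof.
move=> ap.
have E : \forall y \near chart_map a p, y = chart_rep a a id y.
  have : \forall y \near chart_map a p, (chart_map a @` chart_dom a) y.
    apply: open_nbhs_nbhs; split; first exact: chart_img_open.
    by exists p.
  by apply: filterS => y [q aq <-]; rewrite /chart_rep /= chart_mapK.
have did : differentiable (@id 'rV[R]_d) (chart_map a p) by [].
have [_ /(congr1 (@^~ u)) dE] := near_eq_differential E did.
by apply: etrans dE _; rewrite diff_val.
Qed.

Lemma frameK a p : atlas a -> chart_dom a p -> cancel (frame a p) (coframe a p).
Proof.
have iC1 := @id_continuously_differentiable R d M.
move=> aA ap u; rewrite -[RHS](chart_diff_id u ap); symmetry.
by apply: (@chart_diff_comp R d M id id a (chart_at p) a p);
  by [|exact: chart_at_atlas|exact: chart_at_dom].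
Qed.

Lemma coframeK a p : atlas a -> chart_dom a p -> cancel (coframe a p) (frame a p).
Proof.
have iC1 := @id_continuously_differentiable R d M.
move=> aA ap v; rewrite -[RHS](chart_diff_id v (chart_at_dom p)); symmetry.
by apply: (@chart_diff_comp R d M id id (chart_at p) a (chart_at p) p);
  by [|exact: chart_at_atlas|exact: chart_at_dom].
Qed.

Lemma tangent_map_frame a b h p u : continuously_differentiable h ->
  atlas a -> atlas b -> chart_dom a p -> chart_dom b (h p) ->
  tangent_map h p (frame a p u) = frame b (h p) (chart_diff a b h p u).
Proof.
move=> hC1 aA bA ap bhp.
have iC1 := @id_continuously_differentiable R d M.
transitivity (chart_diff a (chart_at (h p)) h p u).
  by symmetry; apply: (@chart_diff_comp R d M id h a (chart_at p) (chart_at (h p)) p);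
   by [|exact: chart_at_atlas|exact: chart_at_dom].
by apply: (@chart_diff_comp R d M h id a b (chart_at (h p)) p);
   by [|exact: chart_at_atlas|exact: chart_at_dom].
Qed.

End Frames.

Section Metric.
Context {R : realType} {d : nat} {M : manifold R d} (g : riemannian_metric M).
Implicit Types (a b c : chart R d M) (h : M -> M) (p : M).

Lemma metric_sum p n (x : 'I_n -> R) (e : 'I_n -> tangent p) (w : tangent p) :
  g p (\sum_i x i *: e i) w = \sum_i x i * g p (e i) w.
Proof.
elim/big_rec2 : _ => [|i y1 y2 _ ih]; last by rewrite metric_linear ih.
apply: (@addrI _ (g p 0 w)).
by rewrite addr0 -{1}[g p 0 w]mul1r -metric_linear scaler0 addr0.
Qed.

(** For fixed [u] and [w] this is a coefficient of the metric in the chart [a],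
    whose smoothness is part of the definition of a Riemannian metric. *)
Lemma metric_frame_continuous a p (u w : 'rV[R]_d) : atlas a -> chart_dom a p ->
  {for p, continuous (fun q => g q (frame a q u) (frame a q w))}.
Proof.
move=> aA ap.
pose G y := g (chart_inv a y) (tangent_of_chart a y u) (tangent_of_chart a y w).
have GE : \forall q \near p, (G \o chart_map a) q = g q (frame a q u) (frame a q w).
  apply: filterS (chart_dom_nbhs ap) => q aq.
  rewrite /G /= /frame /chart_diff /chart_rep /tangent_of_chart.
  set y := chart_map a q.
  have : chart_inv a y = q by exact: chart_mapK.
  (* Abstracting the base point before rewriting lets the types of the tangent
     vectors follow it. *)
  by move: (chart_inv a y) => q' ->.
apply: near_eq_continuous GE _.
apply: continuous_comp; first exact: chart_map_continuous.
by apply: (metric_smooth g aA u w 0%N); exists p.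
Qed.

Lemma metric_sum2 p n (x : 'I_n -> R) (e : 'I_n -> tangent p) :
  g p (\sum_i x i *: e i) (\sum_i x i *: e i) =
  \sum_i \sum_j x i * (x j * g p (e i) (e j)).
Proof.
rewrite metric_sum; apply: eq_bigr => i _.
rewrite (Defs.metric_sym g) metric_sum mulr_sumr.
by apply: eq_bigr => j _; rewrite (Defs.metric_sym g).
Qed.

Lemma tangent_norm_frame_continuous a p (u : 'rV[R]_d) : atlas a -> chart_dom a p ->
  {for (p, u), continuous (fun z : M * 'rV[R]_d =>
    tangent_norm g (frame a z.1 z.2))}.
Proof.
move=> aA ap.
pose e i : 'rV[R]_d := delta_mx 0 i.
have E : \forall z \near (p, u),
    Num.sqrt (\sum_(i < d) \sum_(j < d)
      (z.2 : 'rV[R]_d) 0 i * ((z.2 : 'rV[R]_d) 0 j *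
        g z.1 (frame a z.1 (e i)) (frame a z.1 (e j)))) =
    tangent_norm g (frame a z.1 z.2).
  apply: filterE => -[q v] /=.
  rewrite /tangent_norm [in RHS](row_sum_delta v) linear_sum.
  under [in RHS]eq_bigr do rewrite linearZ.
  by rewrite metric_sum2.
apply: near_eq_continuous E _.
apply: continuous_comp; last exact: sqrt_continuous.
have cc i : (z.2 : 'rV[R]_d) 0 i @[z --> (p, u)] --> u 0 i.
  apply: (@cvg_comp _ _ _ snd (fun v : 'rV[R]_d => v 0 i)).
    exact: cvg_snd.
  exact: coord_continuous.
apply: (@cvg_big _ _ +%R 0) => [|i _]; first exact: add_continuous.
apply: (@cvg_big _ _ +%R 0) => [|j _]; first exact: add_continuous.
apply: cvgM; first exact: cc.
apply: cvgM; first exact: cc.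
have cm := @metric_frame_continuous a p (e i) (e j) aA ap.
exact: (@cvg_comp _ _ _ fst _ _ (nbhs p) _ cvg_fst cm).
Qed.

(** Near [p] the vector [tangent_map h q (frame a q u)] has continuous coordinates
    in a fixed chart around [h p], and the norm is continuous there. *)
Lemma tangent_norm_map_continuous a h p u : continuously_differentiable h ->
  atlas a -> chart_dom a p ->
  {for (p, u), continuous (fun z : M * 'rV[R]_d =>
    tangent_norm g (tangent_map h z.1 (frame a z.1 z.2)))}.
Proof.
move=> hC1 aA ap; have [ch Dh] := hC1.
pose b := chart_at (h p).
have bA : atlas b by exact: chart_at_atlas.
have bhp : chart_dom b (h p) by exact: chart_at_dom.
have E : \forall z \near (p, u),
    tangent_norm g (frame b (h z.1) (chart_diff a b h z.1 z.2)) =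
    tangent_norm g (tangent_map h z.1 (frame a z.1 z.2)).
  have : \forall z \near (p, u), chart_dom a z.1 /\ chart_dom b (h z.1).
    apply: (@near_fst _ _ p u (fun q => chart_dom a q /\ chart_dom b (h q))).
    apply: filterI; last exact: near_chart_dom.
    exact: chart_dom_nbhs.
  apply: filterS => -[q v] [aq bhq].
  exact: (congr1 (@tangent_norm R d M g (h q))
    (esym (@tangent_map_frame R d M a b h q v hC1 aA bA aq bhq))).
apply: near_eq_continuous E _.
have [_ cDh] := Dh a b aA bA p ap bhp.
have ch1 : h z.1 @[z --> (p, u)] --> h p.
  exact: (@cvg_comp _ _ _ fst h _ (nbhs p) _ cvg_fst (ch p)).
have ch2 : (h z.1, chart_diff a b h z.1 z.2) @[z --> (p, u)] -->
    (h p, chart_diff a b h p u).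
  exact: (@cvg_pair _ _ _ (nbhs (p, u)) _ _ _ _ _ (fun z => h z.1)
    (fun z => chart_diff a b h z.1 z.2) ch1 (cDh u)).
have cn := @tangent_norm_frame_continuous b (h p) (chart_diff a b h p u) bA bhp.
exact: (cvg_comp _ (fun z => tangent_norm g (frame b z.1 z.2)) ch2 cn).
Qed.

Lemma metricZZ p (x : R) (v : tangent p) : g p (x *: v) (x *: v) = x ^+ 2 * g p v v.
Proof.
have := @metric_sum2 p 1 (fun=> x) (fun=> v).
by rewrite !big_ord1 mulrA.
Qed.

Lemma tangent_normZ p (x : R) (v : tangent p) :
  tangent_norm g (x *: v) = `|x| * tangent_norm g v.
Proof.
by rewrite /tangent_norm metricZZ sqrtrM ?sqr_ge0// sqrtr_sqr.
Qed.

Lemma tangent_norm_gt0 p (v : tangent p) : v != 0 -> 0 < tangent_norm g v.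
Proof. by move=> v0; rewrite sqrtr_gt0 metric_pos. Qed.

Lemma tangent_norm0 p : tangent_norm g (0 : tangent p) = 0.
Proof. by rewrite -[X in tangent_norm g X](scale0r 0) tangent_normZ normr0 mul0r. Qed.

End Metric.

(** * Uniform stretching by compactness *)

Section Compactness.
Context {R : realType} {d : nat} {M : manifold R d} (g : riemannian_metric M).

Lemma unit_sphere_compact n : compact [set u : 'rV[R]_n | `|u| = 1].
Proof.
apply: bounded_closed_compact.
  by exists 1; split => // x x1 u /= ->; exact: ltW.
apply: (@closed_comp _ _ (fun u : 'rV[R]_n => `|u|) [set 1]).
  by move=> u _; exact: norm_continuous.
exact: closed_eq.
Qed.

Definition stretched (h : M -> M) (s : R) (p : M) (v : tangent p) :=
  s * tangent_norm g v < tangent_norm g (tangent_map h p v).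

Lemma stretchedZ h s p (x : R) (v : tangent p) : x != 0 ->
  stretched h s (x *: v) = stretched h s v.
Proof.
move=> x0; rewrite /stretched linearZ /= !tangent_normZ mulrCA.
by rewrite ltr_pM2l ?normr_gt0.
Qed.

Lemma stretched_open (h : M -> M) (r : R -> R) (t : R) a p (u : 'rV[R]_d) :
  continuously_differentiable h -> {for t, continuous r} ->
  atlas a -> chart_dom a p -> stretched h (r t) (frame a p u) ->
  \forall w \near ((p, u), t), stretched h (r w.2) (frame a w.1.1 w.1.2).
Proof.
move=> hC1 rt aA ap tu.
have c1 : {for ((p, u), t), continuous (fun w : (M * 'rV[R]_d) * R =>
    tangent_norm g (tangent_map h w.1.1 (frame a w.1.1 w.1.2)))}.
  have cn := @tangent_norm_map_continuous R d M g a h p u hC1 aA ap.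
  exact: (@cvg_comp _ _ _ fst _ _ (nbhs (p, u)) _ cvg_fst cn).
have c2 : {for ((p, u), t), continuous (fun w : (M * 'rV[R]_d) * R =>
    r w.2 * tangent_norm g (frame a w.1.1 w.1.2))}.
  have cn := @tangent_norm_frame_continuous R d M g a p u aA ap.
  apply: cvgM.
    exact: (@cvg_comp _ _ _ snd _ _ (nbhs t) _ cvg_snd rt).
  exact: (@cvg_comp _ _ _ fst _ _ (nbhs (p, u)) _ cvg_fst cn).
have c3 : {for ((p, u), t), continuous (fun w : (M * 'rV[R]_d) * R =>
    tangent_norm g (tangent_map h w.1.1 (frame a w.1.1 w.1.2)) -
    r w.2 * tangent_norm g (frame a w.1.1 w.1.2))}.
  by apply: cvgB; [exact: c1|exact: c2].
have pos : 0 < tangent_norm g (tangent_map h p (frame a p u)) -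
    r t * tangent_norm g (frame a p u) by rewrite subr_gt0.
have posn := @cvgr_gt _ _ _ _ _ _ c3 0 pos.
near=> w; rewrite /stretched -subr_gt0; near: w; exact: posn.
Unshelve. all: by end_near. Qed.

(** Compactness of the unit sphere bundle over [L].  The bundle itself is never
    formed: the unit sphere of the coordinates is covered over each point of [L],
    then [L] is covered.  The threshold [r n t] depends on a real parameter so
    that the strict inequality also survives a small increase of [t].  The lemma
    serves twice: with the iterates of a map and thresholds e^(n t), and with a
    constant sequence and threshold [t] near 0. *)
Lemma uniformly_stretched (L : set M) (h : nat -> M -> M) (r : nat -> R -> R)
    (t : R) :
  compact L -> (forall n, continuously_differentiable (h n)) ->
  (forall n, {for t, continuous (r n)}) ->
  (forall p (v : tangent p), L p -> v != 0 ->
    exists n, stretched (h n) (r n t) v) ->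
  exists s N, t < s /\ forall p (v : tangent p), L p -> v != 0 ->
    exists2 n, (n <= N)%N & stretched (h n) (r n s) v.
Proof.
move=> /compact_near_coveringP cL hC1 rt tL.
pose P (sN : R * nat) p := forall v : tangent p, v != 0 ->
    exists2 n, (n <= sN.2)%N & stretched (h n) (r n sN.1) v.
suff [[T N] /= [tT [N0 _ NN]] TNP] :
    \forall sN \near filter_prod (nbhs t) \oo, L `<=` P sN.
  have [s ts Ts] : exists2 s : R, t < s & T s.
    move/nbhs_ballP : tT => [e /= e0 eT]; exists (t + e / 2).
      by rewrite ltrDl divr_gt0.
    apply: eT; rewrite -ball_normE /= opprD addNKr normrN gtr0_norm ?divr_gt0//.
    by rewrite ltr_pdivrMr// ltr_pMr// ltr1n.
  by exists s, N0; split=> // p v Lp; exact: (TNP (s, N0) (conj Ts (NN N0 (leqnn _)))).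
apply: cL => p Lp.
pose a := chart_at p.
have aA : atlas a by exact: chart_at_atlas.
have ap : chart_dom a p by exact: chart_at_dom.
pose Q (w : M * (R * nat)) (u : 'rV[R]_d) :=
  exists2 n, (n <= w.2.2)%N & stretched (h n) (r n w.2.1) (frame a w.1 u).
(* Near [p] the frame of the fixed chart [a] identifies the tangent spaces with
   ['rV_d], whose unit sphere is covered first. *)
have : \forall w \near filter_prod (nbhs p) (filter_prod (nbhs t) \oo),
    [set u : 'rV[R]_d | `|u| = 1] `<=` Q w.
  have /compact_near_coveringP := @unit_sphere_compact d; apply => u /= u1.
  have fu0 : frame a p u != 0.
    apply/eqP => fu; have : u = 0 by rewrite -(frameK aA ap u) fu linear0.
    by move=> u0; move: u1; rewrite u0 normr0 => /esym/eqP; rewrite oner_eq0.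
  have [n tn] := tL p _ Lp fu0.
  have [[X T] /= [[[A B] /= [pA uB] ABX] tT] XTs] :=
    stretched_open (hC1 n) (rt n) aA ap tn.
  exists (B, A `*` (T `*` [set N | (n <= N)%N])) => /=.
    split=> //; exists (A, T `*` [set N | (n <= N)%N]) => //=; split=> //.
    exists (T, [set N | (n <= N)%N]) => //=; split=> //.
    exact: nbhs_infty_ge.
  move=> [u' [q [s N]]] /= [Bu' [Aq [Ts nN]]]; exists n => //=.
  by apply: (XTs ((q, u'), s)); split=> //=; apply: ABX.
move=> [[A B] /= [pA tB] ABQ].
exists (A `&` chart_dom a, B) => /=.
  by split=> //; apply: filterI => //; exact: chart_dom_nbhs.
move=> [q sN] /= [[Aq aq] BsN] v v0.
(* It suffices to stretch the multiple of [v] with coordinates on the sphere. *)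
pose u := coframe a q v.
have u0 : u != 0.
  apply/eqP => u0; move/eqP : v0; apply.
  exact: etrans (esym (coframeK aA aq v))
    (etrans (congr1 (frame a q) u0) (linear0 _)).
have nu1 : `|(`|u|^-1 *: u)| = 1.
  by rewrite normrZ normfV normr_id mulVf// normr_eq0.
have [n nN tn] := ABQ (q, sN) (conj Aq BsN) _ nu1.
exists n => //; rewrite -(@stretchedZ _ _ q `|u|^-1) ?invr_eq0 ?normr_eq0//.
have fE : frame a q (`|u|^-1 *: u) = `|u|^-1 *: v.
  exact: etrans (linearZ _ _)
    (congr1 (fun w => `|u|^-1 *: w) (coframeK aA aq v)).
by rewrite -fE.
Qed.

End Compactness.

(** * The least growth rate of an orbit *)

Section Cocycle.
Context {R : realType} {X : Type} (F : X -> X) (Y : set X) (nu : X -> R).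
Hypotheses (FY : forall z, Y z -> Y (F z)) (nu_gt0 : forall z, Y z -> 0 < nu z).

Let iterY n z : Y z -> Y (iter n F z).
Proof. by move=> Yz; elim: n => //= n; exact: FY. Qed.

(** In the application [Y] is the set of nonzero tangent vectors at points of an
    invariant set, [F] the action of the differential and [nu] the norm. *)
Definition grows_at_rate (c : R) := exists2 K, 0 < K &
  forall z n, Y z -> K * expR (c * n%:R) * nu z <= nu (iter n F z).

(** An orbit is cut into segments of length at most [N], each of which multiplies
    [nu] by at least e^(c k), k being its length.  The last segment may be
    incomplete: its at most [N] steps lose no more than the constant rho^N, rho
    being the ratio of the one-step bound to e^c (capped by 1). *)
Lemma grows_at_rate_of_bounded_times (c kappa : R) (N : nat) : 0 < kappa ->
  (forall z, Y z -> kappa * nu z <= nu (F z)) ->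
  (forall z, Y z -> exists n, [/\ (0 < n)%N, (n <= N)%N &
     expR (c * n%:R) * nu z <= nu (iter n F z)]) ->
  grows_at_rate c.
Proof.
move=> k0 kF tN.
pose rho := Num.min 1 (kappa * expR (- c)).
have rho0 : 0 < rho by rewrite lt_min ltr01 mulr_gt0 ?expR_gt0.
have short n z : Y z -> rho ^+ n * expR (c * n%:R) * nu z <= nu (iter n F z).
  move=> Yz; elim: n => [|n ih]; first by rewrite mulr0 expR0 expr0 !mul1r.
  apply: le_trans (kF _ (iterY n Yz)).
  apply: le_trans (ler_wpM2l (ltW k0) ih).
  rewrite -natr1 mulrDr mulr1 expRD exprS.
  have -> : rho * rho ^+ n * (expR (c * n%:R) * expR c) * nu z =
      (rho * expR c) * (rho ^+ n * expR (c * n%:R) * nu z) by ring.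
  rewrite ler_wpM2r ?mulr_ge0 ?exprn_ge0 ?expR_ge0 ?(ltW rho0) ?(ltW (nu_gt0 Yz))//.
  by rewrite -ler_pdivlMr ?expR_gt0// -expRN ge_min lexx orbT.
exists (rho ^+ N); first exact: exprn_gt0.
move=> z n; elim: n {-2}n (leqnn n) z => [|m IH] n.
  rewrite leqn0 => /eqP-> z Yz; rewrite mulr0 expR0 mulr1 /=.
  by rewrite ler_piMl ?(ltW (nu_gt0 Yz))// exprn_ile1 ?(ltW rho0)// ge_min lexx.
move=> nm z Yz; have [nN|Nn] := leqP n N.
  apply: le_trans (short n z Yz); rewrite ler_wpM2r ?(ltW (nu_gt0 Yz))//.
  rewrite ler_wpM2r ?expR_ge0// ler_wiXn2l ?(ltW rho0)// ge_min lexx //.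
have [k [k0' kN kz]] := tN z Yz.
have kn : (k <= n)%N by apply: leq_trans kN (ltnW Nn).
rewrite -{2}(subnK kn) iterD.
have nk : (n - k <= m)%N.
  by rewrite leq_subLR; apply: (leq_trans nm); rewrite -add1n leq_add2r.
apply: le_trans (IH _ nk _ (iterY k Yz)).
apply: le_trans (ler_wpM2l _ kz); last first.
  by rewrite mulr_ge0 ?expR_ge0 ?exprn_ge0 ?(ltW rho0).
by rewrite mulrA -[_ * expR (c * k%:R)]mulrA -expRD -mulrDr -natrD subnK.
Qed.

(** The constant in the lower bound depends on [c] and may degenerate as [c]
    tends to [alpha]; but for each fixed [c] division by n erases it. *)
Lemma exponent_of_growth (alpha : R) z : Y z ->
  (forall n, nu (iter n F z) <= expR (alpha * n%:R) * nu z) ->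
  (forall c, c < alpha -> grows_at_rate c) ->
  n%:R^-1 * ln (nu (iter n F z)) @[n --> \oo] --> alpha.
Proof.
move=> Yz up low.
have nu0 n : 0 < nu (iter n F z) by apply: nu_gt0; exact: iterY.
have vanish (x : R) : n%:R^-1 * x @[n --> \oo] --> 0.
  rewrite -[X in _ --> X](mul0r x); apply: cvgMl.
  by rewrite -(cvg_shiftS (fun n => n%:R^-1 : R)); exact: cvg_harmonic.
apply/cvgrPdist_le => e e0.
have e20 : 0 < e / 2 by rewrite divr_gt0.
have [|K K0 lowK] := low (alpha - e / 2); first by rewrite ltrBlDr ltrDl.
have up0 : \forall n \near \oo, n%:R^-1 * ln (nu z) <= e.
  by apply: (cvgr_le _ (vanish _)).
have low0 : \forall n \near \oo, - (e / 2) <= n%:R^-1 * ln (K * nu z).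
  by apply: (cvgr_ge _ (vanish _)); rewrite oppr_lt0.
near=> n.
have n0 : 0 < n%:R :> R by rewrite ltr0n; near: n; exact: nbhs_infty_gt.
have ninv : 0 < n%:R^-1 :> R by rewrite invr_gt0.
rewrite distrC ler_distl; apply/andP; split.
  have : (alpha - e / 2) * n%:R + ln (K * nu z) <= ln (nu (iter n F z)).
    have Knu : 0 < K * nu z by rewrite mulr_gt0 ?nu0 ?(nu_gt0 Yz).
    rewrite -[X in X + _]expRK -lnM ?posrE ?expR_gt0//.
    rewrite ler_ln ?posrE ?mulr_gt0 ?expR_gt0 ?nu0 ?(nu_gt0 Yz)//.
    by have := lowK z n Yz; rewrite mulrCA mulrA.
  move=> /(ler_wpM2l (ltW ninv)) /(le_trans _); apply.
  rewrite mulrDr mulrCA mulVf ?gt_eqF// mulr1.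
  have : - (e / 2) <= n%:R^-1 * ln (K * nu z) by near: n.
  by move=> ?; lra.
have : ln (nu (iter n F z)) <= alpha * n%:R + ln (nu z).
  rewrite -[X in X + _]expRK -lnM ?posrE ?expR_gt0 ?nu0 ?(nu_gt0 Yz)//.
  by rewrite ler_ln ?posrE ?mulr_gt0 ?expR_gt0 ?nu0 ?(nu_gt0 Yz).
move=> /(ler_wpM2l (ltW ninv)) /le_trans; apply.
rewrite mulrDr mulrCA mulVf ?gt_eqF// mulr1 lerD2l.
by near: n.
Unshelve. all: by end_near. Qed.

(** This is what compactness provides. *)
Hypothesis uniform_growth : forall c,
  (forall z, Y z -> exists n, expR (c * n%:R) * nu z < nu (iter n F z)) ->
  exists c' N, c < c' /\ forall z, Y z ->
    exists2 n, (n <= N)%N & expR (c' * n%:R) * nu z < nu (iter n F z).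

Hypothesis one_step : exists2 kappa, 0 < kappa &
  forall z, Y z -> kappa * nu z <= nu (F z).

Let slow (c : R) := exists2 z, Y z &
  forall n, nu (iter n F z) <= expR (c * n%:R) * nu z.

Let fast c : ~ slow c ->
  forall z, Y z -> exists n, expR (c * n%:R) * nu z < nu (iter n F z).
Proof.
move=> nc z Yz; apply: contrapT => nex; apply: nc; exists z => // n.
by rewrite leNgt; apply/negP => ?; apply: nex; exists n.
Qed.

Let grows c : ~ slow c -> grows_at_rate c.
Proof.
move=> /fast/uniform_growth[c' [N [cc' tN]]].
have [kappa k0 kF] := one_step.
apply: (grows_at_rate_of_bounded_times (N := N) k0 kF) => z Yz.
have [[|n] nN tn] := tN z Yz.
  (* At time 0 nothing is strictly stretched. *)
  by move: tn; rewrite mulr0 expR0 mul1r ltxx.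
exists n.+1; split=> //; apply: le_trans (ltW tn).
by rewrite ler_wpM2r ?(ltW (nu_gt0 Yz))// ler_expR ler_wpM2r// ltW.
Qed.

(** [alpha] is the infimum of the slow rates.  It is slow itself, since the rates
    that are not slow form an open set; and no smaller rate is slow, so that the
    vector witnessing it grows exactly at rate [alpha]. *)
Lemma least_exponent : ~ (exists2 c, 0 < c & grows_at_rate c) ->
  exists2 alpha : R, alpha <= 0 & exists2 z, Y z &
    n%:R^-1 * ln (nu (iter n F z)) @[n --> \oo] --> alpha.
Proof.
move=> ngrow.
have slow_pos c : 0 < c -> slow c.
  by move=> c0; apply: contrapT => /grows gc; apply: ngrow; exists c.
have [kappa k0 kF] := one_step.
have slow_lb : lbound slow (ln kappa).
  move=> c [z Yz /(_ 1%N)]; rewrite mulr1 /= => zc.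
  rewrite -ler_expR lnK ?posrE// -(ler_pM2r (nu_gt0 Yz)).
  exact: le_trans (kF z Yz) zc.
have hlb : has_lbound slow by exists (ln kappa).
have slow0 : slow !=set0 by exists 1; exact: slow_pos.
pose alpha := inf slow.
have lt_alpha c : c < alpha -> ~ slow c.
  by move=> ca sc; have := ge_inf hlb sc; rewrite leNgt ca.
have slow_alpha : slow alpha.
  apply: contrapT => /fast/uniform_growth[c' [N [cc' tN]]].
  suff : c' <= alpha by rewrite leNgt cc'.
  apply: lb_le_inf => // c [z Yz zc]; rewrite leNgt; apply/negP => cc.
  have [n _] := tN z Yz; apply/negP; rewrite -leNgt.
  apply: le_trans (zc n) _.
  by rewrite ler_wpM2r ?(ltW (nu_gt0 Yz))// ler_expR ler_wpM2r// ltW.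
exists alpha.
  rewrite leNgt; apply/negP => a0; apply: ngrow; exists (alpha / 2).
    by rewrite divr_gt0.
  by apply: grows; apply: lt_alpha; rewrite ltr_pdivrMr// ltr_pMr// ltr1n.
have [z Yz zup] := slow_alpha; exists z => //.
by apply: exponent_of_growth => // c ca; apply: grows; exact: lt_alpha.
Qed.

End Cocycle.

(** * The action on tangent vectors *)

Section TangentDynamics.
Context {R : realType} {d : nat} {M : manifold R d}.

(** The second component is read as an element of [tangent z.1]; the product type
    avoids carrying the base point in the type of the vector. *)
Definition tangent_step (f : M -> M) (z : M * 'rV[R]_d) : M * 'rV[R]_d :=
  (f z.1, tangent_map f z.1 z.2).

Lemma tangent_map_id (p : M) (v : tangent p) : tangent_map id p v = v :> 'rV[R]_d.
Proof. exact: chart_diff_id (chart_at_dom p). Qed.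

Lemma iter_tangent_step f n (p : M) (v : tangent p) : continuously_differentiable f ->
  iter n (tangent_step f) (p, v) = (iter n f p, tangent_map (iter n f) p v).
Proof.
move=> fC1; elim: n => [|n ih]; first by rewrite /= (@tangent_map_id p v).
have itC1 := iter_continuously_differentiable n fC1.
rewrite iterS ih /tangent_step /=; congr pair.
exact: esym (tangent_map_comp v itC1 fC1).
Qed.

End TangentDynamics.

Theorem theorem2 (R : realType) (d : nat) (hd : (1 <= d)%N)
    (M : manifold R d) (hM : compact [set: M]) (g : riemannian_metric M)
    (f : M -> M) (hf : C1_map f)
    (L : set M) (hLc : compact L) (hLi : f @` L `<=` L)
    (hLcrit : forall x, L x -> ~ critical_point f x)
    (hpos : forall l : R, lyapunov_exponents g f L l -> 0 < l) :
  uniformly_expanding g f L.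
Proof.
have fC1 := C1_map_continuously_differentiable hf.
have fnC1 n := iter_continuously_differentiable n fC1.
pose nu (z : M * 'rV[R]_d) := @tangent_norm R d M g z.1 z.2.
pose Y := [set z : M * 'rV[R]_d | L z.1 /\ z.2 != 0].
pose F := @tangent_step R d M f.
have nuF n p v : nu (iter n F (p, v)) = tangent_norm g (tangent_map (iter n f) p v).
  by rewrite /F (@iter_tangent_step R d M f n p v fC1).
have nu_gt0 z : Y z -> 0 < nu z by move=> [_ z0]; exact: tangent_norm_gt0.
have Df0 p (v : tangent p) : L p -> v != 0 -> tangent_map f p v != 0.
  move=> Lp v0; apply/eqP => /(tangent_map_inj (hLcrit _ Lp)) v0'.
  by move/eqP : v0; apply.
have FY z : Y z -> Y (F z).
  by case: z => p v [/= Lp v0]; split; [apply: hLi; exists p|exact: Df0].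
have one_step : exists2 kappa : R, 0 < kappa &
    forall z, Y z -> kappa * nu z <= nu (F z).
  (* Threshold [t] itself, at [t = 0]: every nonzero vector has a nonzero image,
     and by compactness some positive threshold is still exceeded. *)
  have [n||kappa [N [k0 kN]]] :=
      @uniformly_stretched R d M g L (fun=> f) (fun=> id) 0 hLc (fun=> fC1).
  - exact: cvg_id.
  - move=> p v Lp v0; exists 0%N.
    by rewrite /stretched mul0r; apply: tangent_norm_gt0; exact: Df0.
  exists kappa => // -[p v] [/= Lp v0].
  by have [n _ kv] := kN p v Lp v0; exact: ltW.
have uniform_growth c :
    (forall z, Y z -> exists n, expR (c * n%:R) * nu z < nu (iter n F z)) ->
    exists c' N, c < c' /\ forall z, Y z ->
      exists2 n, (n <= N)%N & expR (c' * n%:R) * nu z < nu (iter n F z).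
  move=> grow.
  have [n||c' [N [cc' cN]]] := @uniformly_stretched R d M g L
      (fun n => iter n f) (fun n s => expR (s * n%:R)) c hLc fnC1.
  - apply: continuous_comp; last exact: continuous_expR.
    exact: mulrr_continuous.
  - move=> p v Lp v0; have [n] := grow (p, v) (conj Lp v0).
    by rewrite nuF; exists n.
  exists c', N; split=> // -[p v] [/= Lp v0].
  by have [n nN cv] := cN p v Lp v0; exists n => //; rewrite nuF.
have [[c c0 [K K0 grow]]|] := pselect (exists2 c, 0 < c & grows_at_rate F Y nu c).
  exists K, c; split=> // p v n Lp _.
  have [->|v0] := eqVneq v 0.
    by rewrite linear0 !tangent_norm0 mulr0.
  by have := grow (p, v) n (conj Lp v0); rewrite nuF.
move=> /(least_exponent FY nu_gt0 uniform_growth one_step).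
move=> [alpha a0 [[p v] [/= Lp v0] cv]].
suff : 0 < alpha by rewrite ltNge a0.
apply: hpos; exists p, v; split => //.
  move=> n; have : 0 < nu (iter n F (p, v)).
    by apply: nu_gt0; elim: n => //= n; exact: FY.
  rewrite nuF => nu0; apply/eqP => vn0; move: nu0; rewrite vn0 tangent_norm0.
  by rewrite ltxx.
by under eq_fun do rewrite -nuF.
Qed.
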